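(* Let $\Sigma$ be a finite alphabet and let $I \subset P \subset \Sigma\times\Sigma\times\Sigma$ be a promise problem which is an injection problem. Then the deterministic communication complexity of $(I,P)$ equals $\lceil \log_2 \chi(I,P) \rceil$.
   Context: A promise problem over a finite alphabet $\Sigma$ is a pair $I \subset P \subset \Sigma^3$: three players receive $a,b,c\in\Sigma$ respectively, with the promise $(a,b,c)\in P$, and must decide whether $(a,b,c)\in I$. Deterministic communication uses a shared blackboard: players act in cyclic order, and at each stage a player (as a function of its own input and the current blackboard) either appends bits to the blackboard, accepts, or rejects; an input is accepted iff all players accept. A protocol solves $(I,P)$ if it accepts every input of $I$ and rejects every input of $P\setminus I$ (no requirement outside $P$). The deterministic communication complexity $\mathrm{cc}(I,P)$ is the minimum, over protocols solving $(I,P)$, of the maximum number of bits written. Let $\pi_1,\pi_2,\pi_3:\Sigma^3\to\Sigma$ be the coordinate projections. $(I,P)$ is an injection problem if for every $a\in\Sigma$ there is at most one pair $(b,c)$ with $(a,b,c)\in I$, and similarly for the second and third coordinates. A set $S\subset\Sigma^3$ is a permutation of an identity tensor if each element of $\pi_1(S)$ (resp. $\pi_2(S)$, $\pi_3(S)$) occurs in exactly one triple of $S$. A subset $S\subset I$ is independent (in $(I,P)$) if $S$ is a permutation of an identity tensor and $P\cap(\pi_1(S)\times\pi_2(S)\times\pi_3(S)) = S$. A proper coloring is a map $\tau: I\to[k]$ all of whose color classes $\tau^{-1}(c)$ are independent, and the chromatic number $\chi(I,P)$ is the least $k$ admitting a proper coloring $\tau:I\to[k]$.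
   Formalization: Protocols are required to be self-delimiting: for each player and blackboard, the non-rejecting actions over its inputs are all ''accept'' or append messages forming a prefix-free set. Without this, equality on 3 letters takes 1 bit while the chromatic number is 3. *)

(* Defs.v *)
From mathcomp Require Import all_boot boolp.

Set Implicit Arguments.
Unset Strict Implicit.
Unset Printing Implicit Defensive.

Section PromiseProblems.

Variable Sigma : finType.

Notation triple := (Sigma * Sigma * Sigma)%type.

Record promise_problem := PromiseProblem {
  instance : {set triple};
  promise : {set triple};
  instance_promise : instance \subset promise
}.

Implicit Types (pb : promise_problem) (S : {set triple}) (x : triple).

(* The projections pi_1, pi_2, pi_3, indexed by the players 0, 1, 2. *)
Definition coord (i : 'I_3) (x : triple) : Sigma :=
  tnth [tuple x.1.1; x.1.2; x.2] i.

Definition injection_problem pb : Prop :=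
  forall (i : 'I_3) (a : Sigma),
    #|[set x in instance pb | coord i x == a]| <= 1.

Definition perm_identity_tensor S : bool :=
  [forall i : 'I_3, forall a in [set coord i x | x in S],
    #|[set x in S | coord i x == a]| == 1].

(* pi_1(S) x pi_2(S) x pi_3(S) *)
Definition box S : {set triple} :=
  [set x | [forall i : 'I_3, coord i x \in [set coord i y | y in S]]].

Definition independent pb S : bool :=
  [&& S \subset instance pb,
      perm_identity_tensor S
    & promise pb :&: box S == S].

Definition color_class pb k
    (tau : {ffun {x : triple | x \in instance pb} -> 'I_k}) (c : 'I_k) :
    {set triple} :=
  [set val u | u in tau @^-1: [set c]].

Definition proper_coloring pb k
    (tau : {ffun {x : triple | x \in instance pb} -> 'I_k}) : bool :=
  [forall c : 'I_k, independent pb (color_class tau c)].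

Definition colorable pb (k : nat) : bool :=
  [exists tau : {ffun {x : triple | x \in instance pb} -> 'I_k},
    proper_coloring tau].

Lemma box1 x : box [set x] = [set x].
Proof.
apply/setP=> y; rewrite !inE; apply/forallP/eqP => [h|-> i]; last first.
  by apply/imsetP; exists x; rewrite ?inE.
have e i : coord i y = coord i x.
  by have /imsetP[z] := h i; rewrite inE => /eqP ->.
case: x y {h} e => [[x1 x2] x3] [[y1 y2] y3] e.
have := e (@Ordinal 3 0 isT); rewrite /coord !(tnth_nth x1) /= => ->.
have := e (@Ordinal 3 1 isT); rewrite /coord !(tnth_nth x1) /= => ->.
by have := e (@Ordinal 3 2 isT); rewrite /coord !(tnth_nth x1) /= => ->.
Qed.

Lemma independent1 pb x : x \in instance pb -> independent pb [set x].
Proof.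
move=> xI; rewrite /independent sub1set xI /= box1; apply/andP; split.
  apply/forallP=> i; apply/forall_inP=> a /imsetP[y].
  rewrite inE => /eqP -> ->; apply/eqP.
  rewrite -(cards1 x); apply: eq_card => z; rewrite !inE.
  by case: (z =P x) => // ->; rewrite eqxx.
by apply/eqP/setIidPr; rewrite sub1set (subsetP (instance_promise pb)).
Qed.

Lemma colorable_exists pb : exists k, colorable pb k.
Proof.
exists #|{: {x : triple | x \in instance pb}}|; apply/existsP.
exists [ffun u => enum_rank u]; apply/forallP=> c.
suff -> : color_class [ffun u => enum_rank u] c = [set val (enum_val c)].
  exact/independent1/(valP (enum_val c)).
rewrite /color_class -imset_set1.
suff -> : [ffun u => enum_rank u] @^-1: [set c] = [set enum_val c] by [].
by apply/setP=> u; rewrite !inE ffunE -(inj_eq enum_val_inj) enum_rankK.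
Qed.

Definition chromatic_number pb : nat := ex_minn (colorable_exists pb).

Inductive action := Append of seq bool | Accept | Reject.

(* Without a convention on messages, a player could convey information by the
   length of its message, or by accepting instead of writing: with the outcomes
   "stop", "0", "1" a single written bit would separate three cases.  As usual
   for deterministic protocols, whether a player goes on writing, and where its
   message ends, must be readable off the blackboard: on a given blackboard the
   possible messages of a player form a prefix-free set, and accepting is not
   an alternative to writing.  Rejecting ends the run and is unrestricted. *)
Definition compatible (u v : action) : bool :=
  match u, v with
  | Reject, _ | _, Reject => true
  | Accept, Accept => true
  | Append s, Append t => prefix s t ==> (s == t)
  | _, _ => false
  end.

Record protocol := Protocol {
  act : 'I_3 -> Sigma -> seq bool -> action;
  actP : forall (i : 'I_3) (w : seq bool) (a b : Sigma),
    compatible (act i a w) (act i b w)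
}.

(* [outcome pi x i A w v w']: on input x, with player i to move, the players in
   A having already accepted and w on the blackboard, the protocol ends with
   verdict v and final blackboard w'.  A player that has accepted is skipped in
   the cyclic order; a rejection by any player ends the run. *)
Inductive outcome (pi : protocol) (x : triple) :
    'I_3 -> {set 'I_3} -> seq bool -> bool -> seq bool -> Prop :=
| OutcomeAccepted i w :
    outcome pi x i setT w true w
| OutcomeSkip i (A : {set 'I_3}) w v w' :
    A != setT -> i \in A ->
    outcome pi x (ordS i) A w v w' ->
    outcome pi x i A w v w'
| OutcomeAppend i (A : {set 'I_3}) w s v w' :
    i \notin A -> act pi i (coord i x) w = Append s ->
    outcome pi x (ordS i) A (w ++ s) v w' ->
    outcome pi x i A w v w'
| OutcomeAccept i (A : {set 'I_3}) w v w' :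
    i \notin A -> act pi i (coord i x) w = Accept ->
    outcome pi x (ordS i) (i |: A) w v w' ->
    outcome pi x i A w v w'
| OutcomeReject i (A : {set 'I_3}) w :
    i \notin A -> act pi i (coord i x) w = Reject ->
    outcome pi x i A w false w.

Definition run (pi : protocol) x (v : bool) (w : seq bool) : Prop :=
  outcome pi x ord0 set0 [::] v w.

Definition solves (pi : protocol) pb : Prop :=
  forall x, x \in promise pb -> exists w, run pi x (x \in instance pb) w.

Definition writes_at_most (pi : protocol) pb (d : nat) : Prop :=
  forall x v w, x \in promise pb -> run pi x v w -> size w <= d.

Definition solvable_within pb (d : nat) : Prop :=
  exists pi : protocol, solves pi pb /\ writes_at_most pi pb d.

Lemma outcome_fun pi x i A w v1 w1 v2 w2 :
  outcome pi x i A w v1 w1 -> outcome pi x i A w v2 w2 -> v1 = v2 /\ w1 = w2.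
Proof.
move=> h; elim: h v2 w2 => {i A w v1 w1}
  [i w|i A w v w' AT iA _ IH|i A w s v w' iA e _ IH|i A w v w' iA e _ IH
  |i A w iA e] v2 w2 h2.
- by inversion h2; subst => //; first [rewrite eqxx in H | rewrite inE in H].
- inversion h2; subst; first by rewrite eqxx in AT.
  + exact: IH.
  + by rewrite iA in H.
  + by rewrite iA in H.
  + by rewrite iA in H.
- inversion h2; subst; first by rewrite inE in iA.
  + by rewrite H0 in iA.
  + by move: H0; rewrite e => -[es]; subst; apply: IH.
  + by rewrite e in H0.
  + by rewrite e in H0.
- inversion h2; subst; first by rewrite inE in iA.
  + by rewrite H0 in iA.
  + by rewrite e in H0.
  + exact: IH.
  + by rewrite e in H0.
- inversion h2; subst; first by rewrite inE in iA.
  + by rewrite H0 in iA.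
  + by rewrite e in H0.
  + by rewrite e in H0.
  + by [].
Qed.

(* The first two players write their whole inputs and the third one decides. *)
Definition onehot (a : Sigma) : seq bool := [seq b == a | b <- enum Sigma].

Lemma size_onehot a : size (onehot a) = #|Sigma|.
Proof. by rewrite size_map -cardE. Qed.

Lemma onehot_inj : injective onehot.
Proof.
move=> a b /eq_in_map/(_ a); rewrite mem_enum eqxx => /(_ isT)/esym.
by move/eqP.
Qed.

Definition trivial_act pb (i : 'I_3) (a : Sigma) (w : seq bool) : action :=
  if i == ord_max then
    if [exists x in instance pb,
         (w == onehot (coord ord0 x) ++ onehot (coord (inord 1) x)) &&
         (coord ord_max x == a)]
    then Accept else Reject
  else if size w == #|Sigma| + #|Sigma| then Accept else Append (onehot a).

Lemma trivial_actP pb i w a b :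
  compatible (trivial_act pb i a w) (trivial_act pb i b w).
Proof.
rewrite /trivial_act; case: ifP => _; first by case: ifP => _; case: ifP.
case: ifP => //= _; apply/implyP => /prefixP[t et].
have /eqP := congr1 size et.
rewrite size_cat !size_onehot -[X in X == _]addn0 eqn_add2l eq_sym.
by move=> /eqP/size0nil t0; rewrite et t0 cats0.
Qed.

Lemma solvable_exists pb : exists d, `[< solvable_within pb d >].
Proof.
exists (#|Sigma| + #|Sigma|); apply/asboolP.
pose pi := Protocol (@trivial_actP pb); exists pi.
suff main x : exists2 w, run pi x (x \in instance pb) w
                       & size w <= #|Sigma| + #|Sigma|.
  split=> [x _|x v w _ h]; first by have [w h _] := main x; exists w.
  by have [w0 h0] := main x; have [_ ->] := outcome_fun h0 h.
have n0 : 0 < #|Sigma| by apply/card_gt0P; exists (coord ord0 x).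
set w1 := onehot (coord ord0 x).
set w2 := w1 ++ onehot (coord (inord 1) x).
have sw2 : size w2 = #|Sigma| + #|Sigma| by rewrite size_cat !size_onehot.
exists w2; last by rewrite sw2.
have S0 : ordS ord0 = inord 1 :> 'I_3 by apply/val_inj; rewrite /= inordK.
have S1 : ordS (inord 1) = ord_max :> 'I_3.
  by apply/val_inj; rewrite /= inordK.
have S2 : ordS ord_max = ord0 :> 'I_3 by apply/val_inj.
have n1 : (inord 1 == ord_max :> 'I_3) = false.
  by apply/eqP => /(congr1 val); rewrite /= inordK.
have n10 : (inord 1 == ord0 :> 'I_3) = false.
  by apply/eqP => /(congr1 val); rewrite /= inordK.
apply: (@OutcomeAppend _ _ _ _ _ w1); rewrite ?inE //=.
  by rewrite /trivial_act /= eq_sym addn_eq0 eqn0Ngt n0.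
rewrite S0; apply: (@OutcomeAppend _ _ _ _ _ (onehot (coord (inord 1) x))).
- by rewrite inE.
- rewrite /= /trivial_act n1 size_onehot -[X in X == _]addn0 eqn_add2l eq_sym.
  by rewrite eqn0Ngt n0.
rewrite S1 -/w2.
have decide : trivial_act pb ord_max (coord ord_max x) w2 =
    if x \in instance pb then Accept else Reject.
  rewrite /trivial_act eqxx; congr (if _ then _ else _).
  apply/exists_inP/idP => [[y yI /andP[]]|xI]; last first.
    by exists x; rewrite // !eqxx.
  rewrite eqseq_cat ?size_onehot // => /andP[/eqP/onehot_inj e0].
  move=> /eqP/onehot_inj e1 /eqP e2.
  suff -> : x = y by [].
  case: x y e0 e1 e2 {yI w1 w2 sw2} => [[x1 x2] x3] [[y1 y2] y3].
  by rewrite /coord !(tnth_nth x1) /= inordK //= => -> -> ->.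
case xI: (x \in instance pb) in decide *; last first.
  by apply: OutcomeReject; rewrite ?inE.
apply: OutcomeAccept => //; first by rewrite inE.
rewrite S2; apply: OutcomeAccept; first by rewrite !inE.
  by rewrite /= /trivial_act /= sw2 eqxx.
rewrite S0; apply: OutcomeAccept; first by rewrite !inE n10 n1.
  by rewrite /= /trivial_act n1 sw2 eqxx.
rewrite (_ : _ |: _ = setT); first exact: OutcomeAccepted.
apply/setP=> i; rewrite !inE -!val_eqE /= inordK //.
by case: i => [[|[|[|]]]].
Qed.

(* cc(I, P): the least d such that some protocol solving (I, P) writes at most
   d bits on every input satisfying the promise. *)
Definition communication_complexity pb : nat := ex_minn (solvable_exists pb).

End PromiseProblems.

(* Main.v *)
Require Import Defs.
From mathcomp Require Import all_boot.
From mathcomp Require Import boolp.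

Set Implicit Arguments.
Unset Strict Implicit.
Unset Printing Implicit Defensive.

(** Upper bound: in an injection problem the first player can read off its own
    input the only instance that it can be part of, so it writes the color of
    that instance, and every player checks that its input occurs in the
    announced color class; independence of the class makes this sound.
    Lower bound: color an instance by the blackboard of its run, padded with
    zeros to length [d].  Final blackboards of accepting runs are prefix-free,
    so padding is injective on them, and inputs mixed from accepting runs with
    the same blackboard are accepted with that blackboard, so the classes are
    independent. *)

(** * Independent sets and colorings of an injection problem *)

Section Coloring.

Variables (Sigma : finType) (pb : promise_problem Sigma).

Notation triple := (Sigma * Sigma * Sigma)%type.
Notation instance_type := {x : triple | x \in instance pb}.

(** The injection property makes every set of instances a permuted identity tensor, since a subset
    has no larger fibers; only the box condition is left to check. *)
Lemma injection_independent (S : {set triple}) :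
  injection_problem pb -> S \subset instance pb ->
  {in promise pb, forall z, z \in box S -> z \in S} -> independent pb S.
Proof.
move=> pb_inj SI Sbox; rewrite /independent SI /=; apply/andP; split.
  apply/forallP=> i; apply/forall_inP=> _ /imsetP[x xS ->].
  rewrite eqn_leq; apply/andP; split; last first.
    by apply/card_gt0P; exists x; rewrite inE xS eqxx.
  apply: leq_trans (pb_inj i (coord i x)); apply/subset_leq_card/subsetP => y.
  by rewrite !inE => /andP[/(subsetP SI) -> ->].
rewrite eqEsubset; apply/andP; split; apply/subsetP => x.
  by rewrite inE => /andP[]; apply: Sbox.
move=> xS; rewrite inE (subsetP (instance_promise pb)) ?(subsetP SI) //= inE.
by apply/forallP => i; apply: imset_f.
Qed.

Lemma independent_box S z :
  independent pb S -> z \in promise pb -> z \in box S -> z \in S.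
Proof. by case/and3P=> _ _ /eqP SE zP zS; rewrite -SE inE zP. Qed.

(** Allows bit strings as colors: [enum_rank] turns any finite type into an ordinal. *)
Lemma colorable_code (T : finType) (f : instance_type -> T) :
  (forall t, independent pb [set val u | u in [set u | f u == t]]) ->
  colorable pb #|T|.
Proof.
move=> ind; apply/existsP; exists [ffun u => enum_rank (f u)].
apply/forallP=> c; rewrite (_ : color_class _ c =
  [set val u | u in [set u | f u == enum_val c]]); first exact: ind.
have fc u : ([ffun u => enum_rank (f u)] u == c) = (f u == enum_val c).
  by rewrite ffunE -(inj_eq enum_val_inj) enum_rankK.
by apply/setP => x; apply/imsetP/imsetP => -[u uc ->]; exists u => //;
  move: uc; rewrite !inE fc.
Qed.

End Coloring.

(** * Accepting runs and their final blackboards *)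

Lemma prefix_comparable (T : eqType) (s t u : seq T) :
  prefix s u -> prefix t u -> prefix s t || prefix t s.
Proof.
rewrite !prefixE => /eqP su /eqP tu; apply/orP.
case: (leqP (size s) (size t)) => [st|/ltnW ts]; [left|right].
  by rewrite -{1}tu take_takel ?su.
by rewrite -{1}su take_takel ?tu.
Qed.

Section Runs.

Variables (Sigma : finType) (pi : protocol Sigma).

Notation triple := (Sigma * Sigma * Sigma)%type.
Implicit Types (x y z : triple) (i : 'I_3) (A : {set 'I_3}).

Lemma outcome_prefix x i A w v w' : outcome pi x i A w v w' -> prefix w w'.
Proof.
elim=> {i A w v w'} // [i w|i A w s v w' _ _ _ ih|i A w _ _].
- exact: prefix_refl.
- exact: prefix_trans (prefix_prefix _ _) ih.
- exact: prefix_refl.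
Qed.

Lemma outcome_accepted x i w v w' :
  outcome pi x i setT w v w' -> v = true /\ w' = w.
Proof. by move=> h; case: (outcome_fun h (OutcomeAccepted pi x i w)). Qed.

Lemma outcome_skip x i A w v w' : A != setT -> i \in A ->
  outcome pi x i A w v w' -> outcome pi x (ordS i) A w v w'.
Proof.
move=> AT iA h; inversion h; subst => //; first by rewrite eqxx in AT.
all: by rewrite iA in H.
Qed.

Lemma outcome_act x i A w v w' : i \notin A -> outcome pi x i A w v w' ->
  match act pi i (coord i x) w with
  | Append s => outcome pi x (ordS i) A (w ++ s) v w'
  | Accept => outcome pi x (ordS i) (i |: A) w v w'
  | Reject => v = false /\ w' = w
  end.
Proof.
move=> iA h; inversion h; subst.
- by rewrite inE in iA.
- by rewrite H0 in iA.
- by rewrite H0.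
- by rewrite H0.
- by rewrite H0.
Qed.

(** Neither action is a rejection, so [compatible] leaves two acceptances or two messages. Both
    messages continue [w] to a prefix of [wy], hence are comparable, and prefix-freeness makes them
    equal. *)
Lemma outcome_same_act x y i A w wx wy : i \notin A ->
  outcome pi x i A w true wx -> outcome pi y i A w true wy -> prefix wx wy ->
  act pi i (coord i x) w = act pi i (coord i y) w.
Proof.
move=> iA /(outcome_act iA) hx /(outcome_act iA) hy pxy.
have := actP pi i w (coord i x) (coord i y).
have := actP pi i w (coord i y) (coord i x).
case: (act pi i (coord i x) w) (act pi i (coord i y) w) hx hy
  => [s||] [t||] //= hx hy; try solve [by [] | by case: hx | by case: hy].
move=> /implyP ts /implyP st.
have := prefix_comparable (prefix_trans (outcome_prefix hx) pxy)
                          (outcome_prefix hy).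
by rewrite !prefix_catr // eqxx => /orP[/st|/ts] /eqP ->.
Qed.

(** By [outcome_same_act] the run on [y] copies each step of the run on [x], and it stops when that
    one does because all players have then accepted. *)
Lemma outcome_prefix_free x y i A w wx wy :
  outcome pi x i A w true wx -> outcome pi y i A w true wy -> prefix wx wy ->
  wx = wy.
Proof.
move=> hx; remember true as v eqn:vT in hx.
elim: hx vT wy => {i A w v wx}
  [i w|i A w v wx AT iA _ ih|i A w s v wx iA e hx ih|i A w v wx iA e hx ih
  |i A w iA e] // vT wy hy pxy.
- by case: (outcome_accepted hy).
- exact: ih (outcome_skip AT iA hy) pxy.
- have hx0 := OutcomeAppend iA e hx; rewrite vT in hx0.
  have := outcome_act iA hy; rewrite -(outcome_same_act iA hx0 hy pxy) e => hy'.
  exact: ih.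
- have hx0 := OutcomeAccept iA e hx; rewrite vT in hx0.
  have := outcome_act iA hy; rewrite -(outcome_same_act iA hx0 hy pxy) e => hy'.
  exact: ih.
Qed.

(** A common final blackboard forces the runs on all [X j] to take the same actions. Player [j] sees
    on [z] what it sees on [X j], so [z] follows them; the induction is on the run of [X ord0]. *)
Lemma outcome_mix (X : 'I_3 -> triple) z i A w w' :
  (forall j, coord j z = coord j (X j)) ->
  (forall j, outcome pi (X j) i A w true w') -> outcome pi z i A w true w'.
Proof.
move=> zX hX; have h0 := hX ord0; remember true as v eqn:vT in h0.
elim: h0 vT hX => {i A w v w'}
  [i w|i A w v w' AT iA _ ih|i A w s v w' iA e h ih|i A w v w' iA e h ih
  |i A w iA e] // vT hX; first exact: OutcomeAccepted.
- by apply: OutcomeSkip => //; apply: ih => // j; apply: outcome_skip (hX j).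
- have ej j : act pi i (coord i (X j)) w = Append s.
    by rewrite (outcome_same_act iA (hX j) (hX ord0)) ?prefix_refl.
  apply: (OutcomeAppend (s := s)); rewrite ?zX //; apply: ih => // j.
  by have := outcome_act iA (hX j); rewrite ej.
- have ej j : act pi i (coord i (X j)) w = Accept.
    by rewrite (outcome_same_act iA (hX j) (hX ord0)) ?prefix_refl.
  apply: OutcomeAccept; rewrite ?zX //; apply: ih => // j.
  by have := outcome_act iA (hX j); rewrite ej.
Qed.

(** The closing round of votes, unrolled over three turns; any player [i] may start it. *)
Lemma outcome_final x i w (f : 'I_3 -> bool) :
  (forall j, act pi j (coord j x) w = if f j then Accept else Reject) ->
  outcome pi x i set0 w [forall j, f j] w.
Proof.
move=> actE.
have Sinj (j : 'I_3) :
    ((ordS j == j) = false) * ((ordS (ordS j) == j) = false).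
  by split; apply/eqP => /(congr1 val); case: j => [[|[|[|j]]] ?].
have rejected j A : ~~ f j -> j \notin A ->
    outcome pi x j A w [forall j, f j] w.
  move=> fj jA; rewrite (_ : [forall j, f j] = false); last first.
    by apply/negbTE/forallPn; exists j.
  by apply: OutcomeReject; rewrite // actE (negbTE fj).
have accepted j A : f j -> j \notin A ->
    outcome pi x (ordS j) (j |: A) w [forall j, f j] w ->
    outcome pi x j A w [forall j, f j] w.
  by move=> fj jA; apply: OutcomeAccept; rewrite // actE fj.
have [fi|fi] := boolP (f i); last by apply: rejected; rewrite ?inE.
apply: (accepted); rewrite ?inE //.
have [fi1|fi1] := boolP (f (ordS i)); last first.
  by apply: rejected; rewrite ?inE ?Sinj.
apply: (accepted); rewrite ?inE ?Sinj //.
have [fi2|fi2] := boolP (f (ordS (ordS i))); last first.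
  by apply: rejected; rewrite ?inE ?Sinj.
apply: (accepted); rewrite ?inE ?Sinj //.
(* Three consecutive turns reach every player. *)
have iT j : j \in [set i; ordS i; ordS (ordS i)].
  rewrite !inE -!val_eqE /=.
  by case: i j {fi fi1 fi2} => [[|[|[|]]] //= _] [[|[|[|]]] //= _].
rewrite (_ : _ |: _ = setT); last first.
  by apply/setP => j; have := iT j; rewrite !inE => <-; do !case: (_ == _).
rewrite (_ : [forall j, f j] = true); first exact: OutcomeAccepted.
apply/forallP => j; have := iT j.
by rewrite !inE => /orP[/orP[]|] /eqP ->.
Qed.

End Runs.

(** * Lower bound: from a protocol to a coloring *)

Lemma size_pad (T : Type) (t : T) d w : size w <= d ->
  size (w ++ nseq (d - size w) t) == d.
Proof. by move=> wd; rewrite size_cat size_nseq subnKC. Qed.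

Lemma solvable_colorable (Sigma : finType) (pb : promise_problem Sigma) d :
  injection_problem pb -> solvable_within pb d -> colorable pb (2 ^ d).
Proof.
move=> pb_inj [pi [sol bound]].
have [w wP] : {w : {x | x \in instance pb} -> seq bool &
    forall u, run pi (val u) true (w u)}.
  apply: (@choice _ _ (fun u t => run pi (val u) true t)) => u.
  have [t] := sol _ (subsetP (instance_promise pb) _ (valP u)).
  by rewrite (valP u); exists t.
have wd u : size (w u) <= d.
  exact: bound (subsetP (instance_promise pb) _ (valP u)) (wP u).
pose code u : d.-tuple bool := Tuple (size_pad false (wd u)).
(* Blackboards with the same padding are prefixes of one string, hence comparable, hence equal by
   prefix-freeness. *)
have code_inj u v : code u = code v -> w u = w v.
  move=> /(congr1 val) /= cuv; case/orP: (prefix_comparable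
    (prefix_prefix (w u) _) (etrans (congr1 _ cuv) (prefix_prefix _ _))) => p.
    exact: outcome_prefix_free (wP u) (wP v) p.
  by rewrite (outcome_prefix_free (wP v) (wP u) p).
rewrite -card_bool -card_tuple; apply: (@colorable_code _ _ _ code) => t.
apply: injection_independent => //.
  by apply/subsetP => _ /imsetP[u _ ->]; apply: valP.
move=> z zP; rewrite inE => /forallP zbox.
(* [U j] is an instance of color [t] that shares coordinate [j] with [z]. *)
have /(_ _)/cid2-/all_sig2[U Ut zU] : forall j : 'I_3, exists2 u,
    code u = t & coord j z = coord j (val u).
  move=> j; have /imsetP[_ /imsetP[u + ->] ->] := zbox j.
  by rewrite inE => /eqP ut; exists u.
have wU j : w (U j) = w (U ord0) by apply: code_inj; rewrite !Ut.
have hz : run pi z true (w (U ord0)).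
  by apply: (outcome_mix zU) => j; rewrite -(wU j); apply: wP.
(* The mixed run accepts [z], and a solving protocol accepts only instances within the promise. *)
have [w' hz'] := sol z zP; have [zI _] := outcome_fun hz' hz.
apply/imsetP; exists (Sub z zI); rewrite // inE -(Ut ord0).
have [_ e] := outcome_fun (wP (Sub z zI)) hz.
by apply/eqP/val_inj; rewrite /= e.
Qed.

(** * Upper bound: from a coloring to a protocol *)

Section Protocol.

Variables (Sigma : finType) (pb : promise_problem Sigma) (d : nat).
Variable code : {x : Sigma * Sigma * Sigma | x \in instance pb} -> d.-tuple bool.

Definition color_check (i : 'I_3) (a : Sigma) (w : seq bool) : bool :=
  [exists u, (coord i (val u) == a) && (code u == w :> seq bool)].

(** Length [d] signals that a color has been announced, so the phase is readable off the blackboard,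
    and all messages having length [d] makes them prefix-free. A player whose input occurs in no
    instance cannot announce a color and rejects. *)
Definition color_act (i : 'I_3) (a : Sigma) (w : seq bool) : action :=
  if size w == d then if color_check i a w then Accept else Reject
  else if [pick u | coord i (val u) == a] is Some u
    then Append (code u) else Reject.

Lemma color_actP i w a b : compatible (color_act i a w) (color_act i b w).
Proof.
rewrite /color_act; case: ifP => _; first by case: ifP => _; case: ifP.
case: pickP => // u _; case: pickP => // v _ /=; apply/implyP.
by rewrite prefixE size_tuple -{1}(size_tuple (code v)) take_size eq_sym.
Qed.

Definition color_protocol := Protocol color_actP.

Hypothesis pb_inj : injection_problem pb.
Hypothesis code_independent : forall u,
  independent pb [set val v | v in [set v | code v == code u]].

Lemma color_check_instance u i : color_check i (coord i (val u)) (code u).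
Proof. by apply/existsP; exists u; rewrite !eqxx. Qed.

(** The instances witnessing the three checks lie in one color class, so [x] is in the box of that
    class, and independence puts it in the class. *)
Lemma color_check_sound x w : x \in promise pb ->
  (forall i, color_check i (coord i x) w) -> x \in instance pb.
Proof.
move=> xP chk; have /existsP[u /andP[_ /eqP uw]] := chk ord0.
have /andP[/subsetP classI _] := code_independent u; apply: classI.
apply: independent_box (code_independent u) xP _; rewrite inE.
apply/forallP => i; have /existsP[v /andP[/eqP <- /eqP vw]] := chk i.
apply: imset_f; apply: imset_f; rewrite inE -val_eqE /=.
by rewrite vw uw.
Qed.

Lemma color_protocol_run x : x \in promise pb ->
  exists2 w, run color_protocol x (x \in instance pb) w & size w <= d.
Proof.
move=> xP; pose passed w := [forall i, color_check i (coord i x) w].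
have final i w : size w = d ->
    outcome color_protocol x i set0 w (passed w) w.
  by move=> wd; apply: outcome_final => j; rewrite /= /color_act wd eqxx.
(* Only for an instance must [w] be the right color; for other promised inputs soundness makes some
   check fail on any [w]. *)
have verdict w :
    (forall xI : x \in instance pb, code (Sub x xI) = w :> seq _) ->
    passed w = (x \in instance pb).
  move=> xw; apply/forallP/idP => [|xI i]; first exact: color_check_sound.
  by rewrite -(xw xI); apply: (color_check_instance (Sub x xI)).
(* For [d = 0] the empty blackboard counts as announced and voting starts at once. *)
have [d0|d0] := eqVneq d 0.
  exists [::] => //; rewrite -(verdict [::]); first exact: final.
  by move=> xI; apply/size0nil; rewrite size_tuple.
have startE : color_act ord0 (coord ord0 x) [::] =
    if [pick u | coord ord0 (val u) == coord ord0 x] is Some u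
    then Append (code u) else Reject.
  by rewrite /color_act eq_sym (negbTE d0).
case: pickP startE => [u /eqP ux|none] startE; last first.
  exists [::] => //; rewrite (_ : x \in _ = false).
    by apply: OutcomeReject; rewrite ?inE.
  by apply/negP => xI; have := none (Sub x xI); rewrite /= eqxx.
exists (code u); last by rewrite size_tuple.
rewrite -(verdict (code u)).
  apply: (OutcomeAppend (pi := color_protocol) _ startE); rewrite ?inE //=.
  exact/final/size_tuple.
move=> xI; congr (tval (code _)); apply: val_inj => /=.
(* If [x] is an instance, it is the instance [u] picked by the first player, as both have the same
   first coordinate. *)
have /card_le1_eqP := pb_inj ord0 (coord ord0 x); apply; rewrite inE.
  by rewrite (valP u) ux eqxx.
by rewrite xI eqxx.
Qed.

Lemma color_protocol_solves : solvable_within pb d.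
Proof.
exists color_protocol; split=> [x xP|x v w xP h].
  by have [w h _] := color_protocol_run xP; exists w.
by have [w0 h0 w0d] := color_protocol_run xP; have [_ ->] := outcome_fun h h0.
Qed.

End Protocol.

Lemma colorable_solvable (Sigma : finType) (pb : promise_problem Sigma) k d :
  injection_problem pb -> colorable pb k -> k <= 2 ^ d -> solvable_within pb d.
Proof.
move=> pb_inj /existsP[tau /forallP tau_proper] kd.
have kd' : k <= #|{: d.-tuple bool}| by rewrite card_tuple card_bool.
(* Colors are named injectively by strings of [d] bits, so the color classes stay the same. *)
pose g c : d.-tuple bool := enum_val (widen_ord kd' c).
have g_inj : injective g.
  by move=> c1 c2 /enum_val_inj/(congr1 val) /= ?; apply: val_inj.
apply: (@color_protocol_solves _ _ _ (fun u => g (tau u))) => // u.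
rewrite (_ : [set _ | _ in _] = color_class tau (tau u)) ?tau_proper //.
apply/setP => x; apply/imsetP/imsetP => -[v vu ->]; exists v => //;
  by move: vu; rewrite !inE (inj_eq g_inj).
Qed.

(* [up_log 2 n] is the least e with n <= 2 ^ e, i.e. the ceiling of log_2 n;
   it is 0 for n = 0, which only occurs when the instance set is empty. *)
Theorem mainTheorem1 (Sigma : finType) (pb : promise_problem Sigma)
  (pb_inj : injection_problem pb) :
  communication_complexity pb = up_log 2 (chromatic_number pb).
Proof.
rewrite /communication_complexity /chromatic_number.
case: ex_minnP => d /asboolP solv d_min; case: ex_minnP => k col k_min.
apply/eqP; rewrite eqn_leq; apply/andP; split.
  apply/d_min/asboolP/(colorable_solvable pb_inj col); exact: up_logP.
by apply: up_log_min => //; apply/k_min/solvable_colorable.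
Qed.
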